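(* For every $I\subset\{1,\dots,n\}$ the unstable manifold $W_I^-$ coincides with the $\mathcal B$-orbit of $\Lambda_I$ in $\mathrm{Lag}_h(\widehat E)$.
   Context: $E$ is a complex Hermitian vector space of dimension $n$ with a fixed orthonormal basis $e_1,\dots,e_n$; $\widehat E=E\oplus E$, $\mathbf e_i=(e_i,0)$, $\mathbf f_i=(0,e_i)$, $J(x,y)=(-y,x)$. $\mathrm{Lag}_h(\widehat E)$ is the set of complex subspaces $L\subset\widehat E$ with $L^\perp=JL$, topologized as a subset of the Grassmannian of $n$-dimensional subspaces of $\widehat E$. For $I\subset\{1,\dots,n\}$ with complement $I^c$ put $\Lambda_I=\mathrm{span}_{\mathbb C}\{\mathbf e_i,\mathbf f_j:i\in I,\ j\in I^c\}$. Fix reals $0<\alpha_1<\cdots<\alpha_n$, let $\widehat A\mathbf e_i=\alpha_i\mathbf e_i$, $\widehat A\mathbf f_i=-\alpha_i\mathbf f_i$, and $W_I^-=\{L\in\mathrm{Lag}_h(\widehat E):\lim_{t\to\infty}e^{-t\widehat A}L=\Lambda_I\}$. $\mathrm{Sp}_h(\widehat E,J)=\{T\in GL_{\mathbb C}(\widehat E):T^*JT=J\}$; it acts on $\mathrm{Lag}_h(\widehat E)$. For $0\le\ell\le n$ let $\mathcal I_\ell=\mathrm{span}_{\mathbb C}\{\mathbf e_i:i>n-\ell\}$. The (real) Borel group is $\mathcal B=\{T\in\mathrm{Sp}_h(\widehat E,J):T\mathcal I_\ell\subset\mathcal I_\ell\ \text{for all }1\le\ell\le n\}$. *)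

(* Defs.v *)
From HB Require Import structures.
From mathcomp Require Import all_boot all_order all_algebra sesquilinear.
From mathcomp Require Import complex.
From mathcomp Require Import all_classical all_reals all_analysis.

Set Implicit Arguments.
Unset Strict Implicit.
Unset Printing Implicit Defensive.

Import Order.TTheory GRing.Theory Num.Theory VectorInternalTheory.
Import numFieldNormedType.Exports.

Local Open Scope classical_set_scope.
Local Open Scope complex_scope.
Local Open Scope ring_scope.

Definition frames (K : numFieldType) (V : vectType K) (k : nat) :
  set 'M[K]_(k, dim V) := [set M | row_free M].
Arguments frames {K} V k.

(* All subspaces of V, with the disjoint union over k of the topologies of the
   Grassmannians Gr(k, V).  Each Gr(k, V) carries the quotient topology of the
   space of k-frames: the rows of a row-free matrix are read as k linearly
   independent vectors of V through the coordinate isomorphism r2v, and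
   mx2vs is the subspace they span. *)
Definition grassmannian (K : numFieldType) (V : vectType K) : Type :=
  {vspace V}.

Section GrassmannianTopology.
Variables (K : numFieldType) (V : vectType K).

HB.instance Definition _ := Choice.on (grassmannian V).

Definition grassmannian_open (U : set (grassmannian V)) : Prop :=
  forall k : nat,
    open ([set M | U (mx2vs (M : 'M[K]_(k, dim V)))]
          : set (subspace (frames V k))).

Let grassmannian_openT : grassmannian_open setT.
Proof. by move=> k; exact: openT. Qed.

Let grassmannian_openI : setI_closed grassmannian_open.
Proof. by move=> A B oA oB k; exact: openI (oA k) (oB k). Qed.

Let grassmannian_open_bigU (I : Type) (f : I -> set (grassmannian V)) :
  (forall i, grassmannian_open (f i)) -> grassmannian_open (\bigcup_i f i).
Proof. by move=> of_ k; apply: bigcup_open => i _; exact: of_. Qed.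

HB.instance Definition _ := isOpenTopological.Build (grassmannian V)
  grassmannian_openT grassmannian_openI grassmannian_open_bigU.

End GrassmannianTopology.

(* The operator exponential, as the sum of its power series in the coordinate
   matrix algebra. *)
Definition explf (K : numFieldType) (V : vectType K) (f : 'End(V)) : 'End(V) :=
  Hom (limn (series (fun k => (k`!%:R)^-1 *: (f2mx f) ^+ k))).

Section DoubleForm.
Variables (C : numClosedFieldType) (E : lmodType C) (h : {dot E for Num.conj}).

Definition double_form (u v : E * E) : C := h u.1 v.1 + h u.2 v.2.

Fact double_form_bilinear :
  bilinear_for (GRing.Scale.Law.clone _ _ *%R _)
    (GRing.Scale.Law.clone _ _ (Num.conj \; *%R) _) double_form.
Proof.
split=> [v a u w|u a v w]; rewrite /applyr /double_form/=.
  by rewrite !linearPl mulrDr addrACA.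
by rewrite !linearPr/= mulrDr addrACA.
Qed.

HB.instance Definition _ := bilinear_isBilinear.Build C (E * E)%type (E * E)%type
  C _ _ double_form double_form_bilinear.

Fact double_form_hermitian (u v : E * E) :
  double_form u v = (-1) ^+ false * (double_form v u)^*.
Proof.
by rewrite expr0 mul1r rmorphD/= [in LHS]/double_form (hermC h u.1)
  (hermC h u.2) !expr0 !mul1r.
Qed.

HB.instance Definition _ := isHermitianSesquilinear.Build C (E * E)%type false
  Num.conj double_form double_form_hermitian.

Fact double_form_dot (u : E * E) : u != 0 -> 0 < double_form u u.
Proof.
case: u => x y; rewrite /double_form/= => xy0.
have [y0|y0] := eqVneq y 0.
  rewrite y0 linear0r addr0 neq0_dnorm_gt0 //.
  by apply: contraNneq xy0 => ->; rewrite y0.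
by rewrite ltr_wpDl ?dnorm_ge0 ?neq0_dnorm_gt0.
Qed.

HB.instance Definition _ := isDotProduct.Build C (E * E)%type
  double_form double_form_dot.

End DoubleForm.

Section HermitianSymplectic.
Variables (C : numClosedFieldType) (E : vectType C) (h : {dot E for Num.conj}).
Local Notation EE := (E * E)%type.

Definition J : 'End(EE) := linfun (fun u : EE => (- u.2, u.1)).

Fact JE (u : EE) : J u = (- u.2, u.1).
Proof.
have J_linear : linear (fun u : EE => (- u.2, u.1) : EE).
  move=> a v w; congr pair => /=; by rewrite opprD scalerN.
pose Jm := GRing.isLinear.Build C EE EE *:%R _ J_linear.
pose Jl : {linear EE -> EE} := HB.pack (fun u : EE => (- u.2, u.1) : EE) Jm.
exact: (lfunE Jl u).
Qed.

Definition lagrangian : set (grassmannian EE) :=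
  [set L | orthov (double_form h) L = (J @: L)%VS].

Definition adjoint (T S : 'End(EE)) : Prop :=
  forall u v, double_form h (T u) v = double_form h u (S v).

(* T' is the adjoint of T, unique since the form is nondegenerate. *)
Definition symplectic : set 'End(EE) :=
  [set T | lker T = 0%VS /\
           exists2 T', adjoint T T' & (T' \o J \o T)%VF = J].

Variables (n : nat) (e : n.-tuple E).

Definition be (i : 'I_n) : EE := (tnth e i, 0).
Definition bf (i : 'I_n) : EE := (0, tnth e i).

Definition Lambda (I : {set 'I_n}) : grassmannian EE :=
  (<<[seq be i | i in I]>> + <<[seq bf j | j in ~: I]>>)%VS.

(* The index i : 'I_n stands for the index i.+1 of the mathematical text. *)
Definition isotropic_flag (l : nat) : {vspace EE} :=
  <<[seq be i | i : 'I_n <- enum 'I_n & (n - l < i.+1)%N]>>%VS.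

Definition borel : set 'End(EE) :=
  [set T | symplectic T /\
    forall l, (1 <= l <= n)%N ->
      (T @: isotropic_flag l <= isotropic_flag l)%VS].

End HermitianSymplectic.

Definition unstable_manifold (R : realType) (E : vectType R[i])
    (h : {dot E for Num.conj}) (n : nat) (e : n.-tuple E)
    (A : 'End((E * E)%type)) (I : {set 'I_n}) : set (grassmannian (E * E)%type) :=
  [set L | lagrangian h L /\
    ((explf ((- t)%:C *: A) @: (L : {vspace E * E}))%VS
       : grassmannian (E * E)%type) @[t --> +oo] --> Lambda e I].

(* Main.v *)
Require Import Defs.
From HB Require Import structures.
From mathcomp Require Import all_boot all_order all_algebra sesquilinear.
From mathcomp Require Import complex.
From mathcomp Require Import all_classical all_reals all_analysis.

Set Implicit Arguments.
Unset Strict Implicit.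
Unset Printing Implicit Defensive.

Import Order.TTheory GRing.Theory Num.Theory VectorInternalTheory.
Import numFieldNormedType.Exports.

Local Open Scope classical_set_scope.
Local Open Scope complex_scope.
Local Open Scope ring_scope.

(* The orthonormal basis splits E + E into Lambda_I and Lambda_(I^c), both made
   of eigenlines of A.  If e^(-tA) L tends to Lambda_I then, Lambda_(I^c) being
   A-invariant, L itself is the graph of some X : Lambda_I -> Lambda_(I^c), and
   the flow multiplies the entries of X by exponentials e^(t d); those with d > 0
   must therefore vanish.  The shear id + X, which fixes Lambda_(I^c) pointwise,
   is then symplectic because L is Lagrangian, preserves the flag, and maps
   Lambda_I onto L.  Conversely an element T of the Borel group is triangular with
   nonzero diagonal in the eigenbasis ordered by eigenvalue, so the suitably
   rescaled images e^(-tA) T v of the basis vectors v of Lambda_I tend to v. *)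

(** * Convergence of matrices and of real scalars *)

Lemma cvg_mx (K : topologicalType) (T : Type) (F : set_system T) (m n : nat)
    (f : T -> 'M[K]_(m, n)) (M : 'M[K]_(m, n)) : Filter F ->
  (forall i j, f x i j @[x --> F] --> M i j) -> f x @[x --> F] --> M.
Proof.
move=> FF fM A [P MP PA].
rewrite nbhs_filterE; apply: (filterS (P := fun x => forall i j, P i j (f x i j))).
  by move=> x Px; exact: PA.
by apply: filter_forall => i; apply: filter_forall => j; exact: fM (MP i j).
Qed.

Lemma cvg_sumr (K : numFieldType) (V : pseudoMetricNormedZmodType K)
    (J T : Type) (F : set_system T) (r : seq J) (P : pred J)
    (f : J -> T -> V) (l : J -> V) : Filter F ->
  (forall i, P i -> f i x @[x --> F] --> l i) ->
  \sum_(i <- r | P i) f i x @[x --> F] --> \sum_(i <- r | P i) l i.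
Proof. by apply: cvg_big; exact: pseudometric_normed_Zmodule.add_continuous. Qed.

(** Eventually [f x] and [g x] each stay within half of the gap between the two norms. *)
Lemma cvg_normr_lt (K : numFieldType) (V : pseudoMetricNormedZmodType K)
    (T : Type) (F : set_system T) (f g : T -> V) (a b : V) : Filter F ->
  f x @[x --> F] --> a -> g x @[x --> F] --> b -> `|a| < `|b| ->
  \forall x \near F, `|f x| < `|g x|.
Proof.
move=> FF fa gb ab; have e0 : 0 < (`|b| - `|a|) / 2 by rewrite divr_gt0 ?subr_gt0.
near=> x.
have fx : `|a - f x| < (`|b| - `|a|) / 2.
  by near: x; exact: (@cvgr_dist_lt _ _ _ _ _ _ _ fa).
have gx : `|b - g x| < (`|b| - `|a|) / 2.
  by near: x; exact: (@cvgr_dist_lt _ _ _ _ _ _ _ gb).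
have le_fx : `|f x| <= `|a| + `|a - f x|.
  by rewrite distrC -[X in `|X|](subrK a) addrC ler_normD.
have le_b : `|b| <= `|g x| + `|b - g x|.
  by rewrite -[X in `|X|](subrK (g x)) addrC ler_normD.
apply: le_lt_trans le_fx _; rewrite -(ltrD2r `|b - g x|).
apply: lt_le_trans le_b; rewrite -addrA -ltrBrDl [ltRHS]splitr.
exact: ltrD.
Unshelve. all: by end_near. Qed.

Lemma continuous_det (K : numFieldType) (n : nat) :
  continuous (fun M : 'M[K]_n => \det M).
Proof.
move=> M; apply: (@cvg_sumr K K _ _ (nbhs M)) => s _.
apply: cvgM; first exact: cvg_cst.
apply: (@cvg_big K _ _ _ _ (@mul_continuous K) _ (nbhs M)) => i _.
exact: coord_continuous.
Qed.

Lemma continuous_mulmxl (K : numFieldType) (m n p : nat) (A : 'M[K]_(n, p)) :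
  continuous (fun M : 'M[K]_(m, n) => M *m A).
Proof.
move=> M; apply: (@cvg_mx K _ (nbhs M)) => i j; rewrite mxE.
under eq_fun do rewrite mxE.
apply: (@cvg_sumr K K _ _ (nbhs M)) => k _.
by apply: cvgM; [exact: coord_continuous | exact: cvg_cst].
Qed.

Lemma continuous_adj (K : numFieldType) (n : nat) :
  continuous (fun M : 'M[K]_n => \adj M).
Proof.
move=> M; apply: (@cvg_mx K _ (nbhs M)) => i j; rewrite mxE.
under eq_fun do rewrite mxE.
apply: cvgM; first exact: cvg_cst.
apply: (cvg_comp (fun N : 'M[K]_n => row' j (col' i N)) (fun N => \det N));
  last exact: continuous_det.
apply: (@cvg_mx K _ (nbhs M)) => k l; rewrite !mxE.
under eq_fun do rewrite !mxE.
exact: coord_continuous.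
Qed.

Lemma cvg_realc (R : realType) (T : Type) (F : set_system T) (f : T -> R) (l : R) :
  Filter F -> f x @[x --> F] --> l ->
  ((f x)%:C : (R[i] : numFieldType)) @[x --> F] --> (l%:C : (R[i] : numFieldType)).
Proof.
move=> FF fl; apply/(@cvgrPdist_lt _ _ _ _ FF) => eps.
(* A positive element of [R[i]] is real, so [eps] amounts to the positive real tolerance given by
   its real part. *)
rewrite ltcE => /andP[/eqP im0 re0].
have := @cvgr_dist_lt R R T F FF f l fl _ re0.
apply: filterS => x.
by rewrite -rmorphB normc_def /= expr0n addr0 sqrtr_sqr ltcE /= im0 eqxx.
Qed.

(** * Exponential of a diagonalizable operator *)

Lemma v2r_lfun (K : nzSemiRingType) (aT rT : semiVectType K) (f : 'Hom(aT, rT)) v :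
  v2r (f v) = v2r v *m f2mx f.
Proof. by rewrite unlock /= r2vK. Qed.

Lemma eq_mulrV (K : pzSemiRingType) (m n : nat) (M N : 'M[K]_(m, n)) :
  (forall r : 'rV_m, r *m M = r *m N) -> M = N.
Proof. by move=> MN; apply/row_matrixP => i; rewrite !rowE MN. Qed.

Section Explf.
Variables (K : numFieldType) (V : vectType K) (J : finType).
Variables (f : 'End(V)) (p : J -> 'End(V)) (c : J -> K).
Hypothesis sum_p : (\sum_j p j = \1)%VF.
Hypothesis f_p : forall j, (f \o p j)%VF = c j *: p j.

(** Since [f] acts as [c j] on the image of [p j], its powers act termwise on the resolution of the
    identity. Matrices act on row vectors. *)
Lemma spectral_f2mxX k :
  f2mx f ^+ k = \sum_j c j ^+ k *: f2mx (p j).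
Proof.
apply: eq_mulrV => r; rewrite -[r]r2vK; move: (r2v r) => v {r}.
suff -> : v2r v *m f2mx f ^+ k = v2r (\sum_j c j ^+ k *: p j v).
  rewrite linear_sum mulmx_sumr; apply: eq_bigr => j _.
  by rewrite linearZ /= v2r_lfun scalemxAr.
elim: k => [|k IHk].
  rewrite expr0 mulmx1 -[in LHS](id_lfunE v) -sum_p sum_lfunE; congr v2r.
  by apply: eq_bigr => j _; rewrite expr0 scale1r.
rewrite exprSr mulmxA IHk -v2r_lfun linear_sum; congr v2r.
apply: eq_bigr => j _.
by rewrite linearZ /= -comp_lfunE f_p scale_lfunE scalerA exprSr.
Qed.

(** Exchanging the finite sum over [j] with each partial sum of the exponential series leaves one
    scalar series per eigenvalue. *)
Lemma explf_spectral (s : J -> K) :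
  (forall j, series (fun k => (k`!%:R)^-1 * c j ^+ k) x @[x --> \oo] --> s j) ->
  explf f = \sum_j s j *: p j.
Proof.
move=> cs; apply/val_inj => /=.
have -> : f2mx (\sum_j s j *: p j) = \sum_j s j *: f2mx (p j).
  apply: eq_mulrV => r; rewrite -[r]r2vK -v2r_lfun sum_lfunE linear_sum.
  rewrite mulmx_sumr; apply: eq_bigr => j _.
  by rewrite scale_lfunE linearZ /= v2r_lfun scalemxAr.
apply: cvg_lim; first exact: norm_hausdorff.
rewrite (_ : series _ = fun n => \sum_j
    series (fun k => (k`!%:R)^-1 * c j ^+ k) n *: f2mx (p j)); last first.
  apply/funext => n; rewrite /series /=.
  under eq_bigr do rewrite spectral_f2mxX scaler_sumr.
  rewrite exchange_big; apply: eq_bigr => j _.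
  by rewrite scaler_suml; apply: eq_bigr => k _; rewrite scalerA.
by apply: cvg_sumr => j _; exact: cvgZr_tmp.
Qed.

End Explf.

Lemma cvg_series_expc (R : realType) (x : R) :
  series (fun k => (k`!%:R)^-1 * x%:C ^+ k : (R[i] : numFieldType)) n
    @[n --> \oo] --> ((expR x)%:C : (R[i] : numFieldType)).
Proof.
rewrite (_ : series _ = fun n => (series (exp_coeff x) n)%:C); last first.
  apply/funext => n; rewrite /series /= rmorph_sum; apply: eq_bigr => k _.
  by rewrite exp_coeffE /= rmorphM rmorphXn fmorphV rmorph_nat.
by apply: cvg_realc; exact: is_cvg_series_exp_coeff.
Qed.

(** * Frames and the Grassmannian topology *)

Section Frames.
Variables (K : numFieldType) (V : vectType K).

Lemma eq_mx2vs (k l : nat) (M : 'M[K]_(k, dim V)) (N : 'M[K]_(l, dim V)) :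
  mx2vs M = mx2vs N <-> (M :=: N)%MS.
Proof.
split=> [MN|MN]; last by apply/val_inj/eq_genmx.
by apply: eqmx_trans (mx2vsK N); rewrite -MN; exact/eqmx_sym/mx2vsK.
Qed.

Lemma dim_mx2vs (k : nat) (M : 'M[K]_(k, dim V)) : \dim (mx2vs M) = \rank M.
Proof. by rewrite /dimv mx2vsK. Qed.

Definition frame (k : nat) (g : 'I_k -> V) : 'M[K]_(k, dim V) :=
  \matrix_i v2r (g i).

Lemma memv_frame (k : nat) (g : 'I_k -> V) (w : V) :
  w \in mx2vs (frame g) <-> exists a : 'I_k -> K, w = \sum_i a i *: g i.
Proof.
have -> : (w \in mx2vs (frame g)) = (v2r w <= frame g)%MS.
  by rewrite -[LHS]/(<<v2r w>> <= <<frame g>>)%MS !genmxE.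
split=> [/submxP[a wa]|[a ->]].
  exists (fun i => a 0 i); apply: v2r_inj; rewrite wa mulmx_sum_row linear_sum.
  by apply: eq_bigr => i _; rewrite linearZ /= rowK.
rewrite linear_sum; apply: summx_sub => i _; rewrite linearZ /=.
by apply: scalemx_sub; rewrite -[X in (X <= _)%MS](rowK (v2r \o g)) row_sub.
Qed.

Lemma lfun_img_frame (k : nat) (g : 'I_k -> V) (T : 'End(V)) :
  (T @: mx2vs (frame g))%VS = mx2vs (frame (T \o g)).
Proof.
rewrite unlock; apply/eq_mx2vs.
apply: eqmx_trans (eqmxMr _ (mx2vsK _)) _.
rewrite (_ : frame (T \o g) = frame g *m f2mx T); first exact: eqmx_refl.
by apply/row_matrixP => i; rewrite row_mul !rowK /= v2r_lfun.
Qed.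

(** This freedom absorbs the exponential factors that the flow puts on the vectors of a frame. *)
Lemma mx2vs_frameZ (k : nat) (g : 'I_k -> V) (a : 'I_k -> K) :
  (forall i, a i != 0) ->
  mx2vs (frame (fun i => a i *: g i)) = mx2vs (frame g).
Proof.
move=> a0; apply/vspaceP => w; apply/idP/idP => /memv_frame[b ->]; apply/memv_frame.
  by exists (fun i => b i * a i); apply: eq_bigr => i _; rewrite scalerA.
exists (fun i => b i / a i); apply: eq_bigr => i _.
by rewrite scalerA divfK.
Qed.

Lemma cvg_frame (k : nat) (T : Type) (F : set_system T)
    (f : T -> 'I_k -> V) (g : 'I_k -> V) : Filter F ->
  (forall i, v2r (f x i) @[x --> F] --> v2r (g i)) ->
  frame (f x) @[x --> F] --> frame g.
Proof.
move=> FF fg; apply: cvg_mx => i j; rewrite mxE; under eq_fun do rewrite mxE.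
exact: cvg_comp (fg i) (@coord_continuous K 1 (dim V) 0 j _).
Qed.

(** An open set of subspaces pulls back to a relatively open set of frames, the trace of an open set
    [W] of matrices. Eventually [M x] lies in [W], and it is a frame. *)
Lemma cvg_mx2vs (k : nat) (T : Type) (F : set_system T)
    (M : T -> 'M[K]_(k, dim V)) (N : 'M[K]_(k, dim V)) : Filter F ->
  row_free N -> (forall x, row_free (M x)) -> M x @[x --> F] --> N ->
  (mx2vs (M x) : grassmannian V) @[x --> F] --> (mx2vs N : grassmannian V).
Proof.
move=> FF Nfree Mfree MN A; rewrite nbhsE => -[B [oB BN] BA].
have /open_subspaceP[W oW WB] := (oB : grassmannian_open B) k.
have WN : W N.
  suff : (W `&` frames V k) N by case.
  by rewrite WB; split.
rewrite nbhs_filterE; apply: (@filterS _ F FF (M @^-1` W)); last first.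
  exact: MN _ (open_nbhs_nbhs (conj oW WN)).
move=> x WM; apply: BA.
have : (W `&` frames V k) (M x) by split; [|exact: Mfree].
by rewrite WB => -[].
Qed.

(* By Cramer's rule the inequalities on X = (M P)^-1 (M Q) compare polynomials in
   the entries of the frame M. *)
Lemma open_graph_lt1 (n m : nat) (P : 'M[K]_(dim V, n)) (Q : 'M[K]_(dim V, m))
    (B : 'M[K]_(n, dim V)) (C : 'M[K]_(m, dim V)) :
  B *m P = 1%:M -> C *m P = 0 -> B *m Q = 0 -> C *m Q = 1%:M ->
  P *m B + Q *m C = 1%:M ->
  open ([set L | exists2 X : 'M[K]_(n, m),
    L = mx2vs (B + X *m C)%R & forall i j, `|X i j| < 1] : set (grassmannian V)).
Proof.
move=> BP CP BQ CQ PQ; pose U := [set L | exists2 X : 'M[K]_(n, m),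
  L = mx2vs (B + X *m C)%R & forall i j, `|X i j| < 1].
suff : grassmannian_open (U : set (grassmannian V)) by [].
move=> k; apply/open_subspaceP.
have graphP X : (B + X *m C) *m P = 1%:M by rewrite mulmxDl -mulmxA CP mulmx0 addr0.
have graphQ X : (B + X *m C) *m Q = X by rewrite mulmxDl -mulmxA CQ mulmx1 BQ add0r.
(* Only frames of [n] vectors can span such a graph: [P] is a right inverse of [B + X *m C], which
   therefore has rank [n]. *)
have [kn|kn] := eqVneq k n; last first.
  exists set0; first exact: open0.
  rewrite set0I; apply/esym; rewrite -subset0 => M [/= [X MX _] Mfree].
  move/eqP: kn; apply; move/eq_mx2vs: MX => MX.
  have graph_free : row_free (B + X *m C) by apply/row_freeP; exists P.
  have rankM : \rank M = \rank (B + X *m C)%R by rewrite MX.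
  by rewrite (eqP graph_free) (eqP (Mfree : row_free M)) in rankM.
subst k; pose D (M : 'M[K]_(n, dim V)) := \det (M *m P).
pose Y (M : 'M[K]_(n, dim V)) := \adj (M *m P) *m (M *m Q).
exists [set M | D M != 0 /\ forall i j, `|Y M i j| < `|D M|].
  rewrite openE => M [D0 YD]; rewrite /interior.
  have cD : D N @[N --> M] --> D M.
    exact: cvg_comp (@continuous_mulmxl K n _ n P M) (@continuous_det K n _).
  have cY i j : Y N i j @[N --> M] --> Y M i j.
    rewrite /Y; under eq_fun do rewrite mxE.
    rewrite mxE; apply: (@cvg_sumr K K _ _ (nbhs M)) => l _; apply: cvgM.
      apply: (cvg_comp (fun N => N *m P) (fun N => (\adj N) i l)).
        exact: continuous_mulmxl.
      apply: cvg_comp (@continuous_adj K n _) (@coord_continuous K n n i l _).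
    apply: cvg_comp (@continuous_mulmxl K n _ m Q M) (@coord_continuous K n m l j _).
  have D0' : \forall N \near M, D N != 0 by exact: cvgr_neq0 cD D0.
  have YD' : \forall N \near M, forall i j, `|Y N i j| < `|D N|.
    apply: (@filter_forall _ _ (fun i N => forall j, `|Y N i j| < `|D N|) _
      (nbhs_filter M)) => i.
    apply: (@filter_forall _ _ (fun j N => `|Y N i j| < `|D N|) _
      (nbhs_filter M)) => j.
    by apply: (@cvg_normr_lt K K _ (nbhs M) _ _ _ _ _ (cY i j) cD).
  exact: filterI D0' YD'.
apply/seteqP; split=> M [].
  move=> [D0 YD] Mfree; split=> //.
  have MPu : M *m P \in unitmx by rewrite unitmxE unitfE.
  exists (invmx (M *m P) *m (M *m Q)).
    apply/eq_mx2vs; set X := invmx _ *m _.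
    (* Because [P *m B + Q *m C] is the identity, [M] and the graph frame differ by the invertible
       factor [M *m P]. *)
    have {1}-> : M = M *m P *m (B + X *m C).
      by rewrite mulmxDr mulmxA mulKVmx // -!mulmxA -mulmxDr PQ mulmx1.
    by apply: eqmxMfull; rewrite row_full_unit.
  move=> i j; rewrite /invmx MPu -scalemxAl mxE normrM normfV.
  by rewrite mulrC ltr_pdivrMr ?normr_gt0 // mul1r; exact: YD.
move=> [X /eq_mx2vs MX X1] Mfree; split=> //.
have /submxP[G MG] : (M <= (B + X *m C)%R)%MS by rewrite MX.
have GP : M *m P = G by rewrite MG -mulmxA graphP mulmx1.
(* The rank of [M] is [n] and is at most that of its left factor [G]. *)
have Gu : G \in unitmx.
  rewrite -row_free_unit -row_leq_rank -[X in (X <= _)%N](eqP (Mfree : row_free M)) MG.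
  exact: mxrankM_maxl.
have D0 : D M != 0 by rewrite /D GP -unitfE -unitmxE.
have YX : Y M = D M *: X.
  by rewrite /Y /D GP MG -mulmxA graphQ mulmxA mul_adj_mx mul_scalar_mx.
split=> // i j; rewrite YX mxE normrM -[ltRHS]mulr1.
by rewrite ltr_pM2l ?normr_gt0.
Qed.

End Frames.

(** * Lagrangian subspaces and the Borel group *)

Lemma linfun_linearE (K : nzRingType) (U V : vectType K) (g : U -> V) :
  linear g -> linfun g =1 g.
Proof.
move=> lin_g v; pose gM := GRing.isLinear.Build K U V *:%R _ lin_g.
pose gl : {linear U -> V} := HB.pack g gM.
exact: (lfunE gl v).
Qed.

Section Dot.
Variables (C : numClosedFieldType) (U : lmodType C) (f : {dot U for Num.conj}).

Lemma dot_conj u v : f v u = (f u v)^*.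
Proof. by rewrite hermC expr0 mul1r. Qed.

Lemma dotZl a u v : f (a *: u) v = a * f u v.
Proof. exact: linearZl_LR. Qed.

Lemma dotZr a u v : f u (a *: v) = a^* * f u v.
Proof. exact: linearZr_LR. Qed.

Lemma dot_suml (J : Type) (r : seq J) (P : pred J) (F : J -> U) v :
  f (\sum_(i <- r | P i) F i) v = \sum_(i <- r | P i) f (F i) v.
Proof. exact: linear_sumlz. Qed.

Lemma dot_sumr (J : Type) (r : seq J) (P : pred J) (F : J -> U) v :
  f v (\sum_(i <- r | P i) F i) = \sum_(i <- r | P i) f v (F i).
Proof. exact: linear_sumr. Qed.

Lemma dot_eq0P u : (forall v, f u v = 0) -> u = 0.
Proof.
move=> u0; apply/eqP/negPn/negP => /(@neq0_dnorm_gt0 _ _ _ f).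
by rewrite u0 ltxx.
Qed.

Lemma dot_injl u v : (forall w, f u w = f v w) -> u = v.
Proof.
move=> uv; apply/eqP; rewrite -subr_eq0; apply/eqP/dot_eq0P => w.
by rewrite linearBl /= uv subrr.
Qed.

Lemma dot_injr u v : (forall w, f w u = f w v) -> u = v.
Proof. by move=> uv; apply: dot_injl => w; rewrite dot_conj uv -dot_conj. Qed.

End Dot.

(** * An orthonormal basis adapted to [I], and the form twisted by [J] *)

Section OrthonormalBasis.
Variables (C : numClosedFieldType) (E : vectType C) (h : {dot E for Num.conj}).
Variables (n : nat) (e : n.-tuple E).
Hypothesis e_basis : basis_of {:E}%VS e.
Hypothesis e_orthonormal : orthonormal h e.
Local Notation EE := (E * E)%type.
Local Notation dh := (double_form h).

Lemma orthonormal_tnth i j : h (tnth e i) (tnth e j) = (i == j)%:R.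
Proof.
have [/uniqP e_uniq he] := orthonormalP e_orthonormal.
rewrite he ?mem_tnth //; congr (nat_of_bool _)%:R.
apply/eqP/eqP => [|-> //]; rewrite !(tnth_nth 0) => eij; apply/val_inj.
by apply: e_uniq eij; rewrite inE size_tuple.
Qed.

Lemma orthonormal_expansion v : v = \sum_i h v (tnth e i) *: tnth e i.
Proof.
have := coord_basis e_basis (memvf v) => {1}->.
apply: eq_bigr => i _; rewrite (tnth_nth 0); congr (_ *: _).
rewrite [in RHS](coord_basis e_basis (memvf v)) dot_suml (bigD1 i) //=.
rewrite dotZl -!tnth_nth orthonormal_tnth eqxx mulr1 big1 ?addr0 // => j ji.
by rewrite dotZl -!tnth_nth orthonormal_tnth (negPf ji) mulr0.
Qed.

(* The vectors indexed by (true, _) span Lambda_I, those indexed by (false, _)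
   span Lambda_(I^c). *)
Definition lagr_basis (I : {set 'I_n}) (p : bool * 'I_n) : EE :=
  if p.1 == (p.2 \in I) then be e p.2 else bf e p.2.

Lemma dot_lagr_basis I p q : dh (lagr_basis I p) (lagr_basis I q) = (p == q)%:R.
Proof.
case: p q => [s i] [t j]; rewrite /lagr_basis /double_form xpair_eqE /=.
have [<-|ij] := eqVneq i j.
  case: (i \in I); case: s; case: t => /=;
    by rewrite ?orthonormal_tnth ?eqxx ?linear0r ?linear0l ?addr0 ?add0r.
by rewrite andbF; case: ifP; case: ifP => _ _ /=;
  rewrite ?orthonormal_tnth ?(negPf ij) ?linear0r ?linear0l ?addr0 ?add0r.
Qed.

Lemma sum_lagr_basis (V : nmodType) (F : bool * 'I_n -> V) :
  \sum_p F p = \sum_i F (true, i) + \sum_i F (false, i).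
Proof.
rewrite (eq_bigr (fun p => F (p.1, p.2))); last by case.
by rewrite -(pair_bigA _ (fun s i => F (s, i))) /= big_bool.
Qed.

Lemma lagr_basis_expansion I v :
  v = \sum_p dh v (lagr_basis I p) *: lagr_basis I p.
Proof.
rewrite sum_lagr_basis -big_split /=.
transitivity (\sum_i (h v.1 (tnth e i) *: be e i + h v.2 (tnth e i) *: bf e i)).
  case: v => x y /=; rewrite [RHS]surjective_pairing; congr pair.
    rewrite (big_morph fst (id1 := 0) (op1 := +%R)) // [LHS]orthonormal_expansion.
    by apply: eq_bigr => i _; rewrite /= scaler0 addr0.
  rewrite (big_morph snd (id1 := 0) (op1 := +%R)) // [LHS]orthonormal_expansion.
  by apply: eq_bigr => i _; rewrite /= scaler0 add0r.
apply: eq_bigr => i _; rewrite /lagr_basis /double_form /=.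
case: (i \in I) => /=; last rewrite addrC.
all: by rewrite !linear0r ?addr0 ?add0r.
Qed.

Lemma LambdaE I : Lambda e I = mx2vs (frame (fun i => lagr_basis I (true, i))).
Proof.
apply/vspaceP => v; apply/idP/idP.
  case/memv_addP => u uI [w wI ->]; apply: memvD.
    move: u uI; apply/subvP/span_subvP => _ /mapP[i iI ->].
    rewrite mem_enum in iI; apply/memv_frame; exists (fun j => (j == i)%:R).
    rewrite (bigD1 i) //= eqxx scale1r big1 ?addr0 => [|j /negPf->]; last exact: scale0r.
    by rewrite /lagr_basis /= iI.
  move: w wI; apply/subvP/span_subvP => _ /mapP[i iI ->].
  rewrite mem_enum inE in iI; apply/memv_frame; exists (fun j => (j == i)%:R).
  rewrite (bigD1 i) //= eqxx scale1r big1 ?addr0 => [|j /negPf->]; last exact: scale0r.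
  by rewrite /lagr_basis /= (negPf iI).
move=> /memv_frame[a ->]; apply: memv_suml => i _; apply: memvZ.
rewrite /lagr_basis /=; case: ifP => [iI|iNI].
  apply: (subvP (addvSl _ _)); apply/memv_span/mapP; exists i => //.
  by rewrite mem_enum; case: (i \in I) iI.
apply: (subvP (addvSr _ _)); apply/memv_span/mapP; exists i => //.
by rewrite mem_enum inE; case: (i \in I) iNI.
Qed.

Lemma mem_Lambda I v :
  v \in (Lambda e I : {vspace EE}) <-> forall i, dh v (lagr_basis I (false, i)) = 0.
Proof.
rewrite LambdaE; split=> [/memv_frame[a ->] i|v0].
  rewrite dot_suml big1 // => j _.
  by rewrite dotZl /= dot_lagr_basis mulr0.
apply/memv_frame; exists (fun i => dh v (lagr_basis I (true, i))).
rewrite [LHS](lagr_basis_expansion I) sum_lagr_basis [X in _ + X]big1 ?addr0 // => i _.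
by rewrite v0 scale0r.
Qed.

(** [J] exchanges [be i] and [bf i] up to sign, hence also the two halves of the basis. The sign
    depends on [s] and [I]; only its being nonzero is recorded. *)
Lemma J_lagr_basis I s i : exists2 a : C, a != 0 &
  J E (lagr_basis I (s, i)) = a *: lagr_basis I (~~ s, i).
Proof.
rewrite JE /lagr_basis /be /bf /=; case: (i \in I); case: s => /=.
- by exists 1; rewrite ?oner_eq0 // oppr0 scale1r.
- by exists (- 1); rewrite ?oppr_eq0 ?oner_eq0 // scaleN1r; congr pair; rewrite oppr0.
- by exists (- 1); rewrite ?oppr_eq0 ?oner_eq0 // scaleN1r; congr pair; rewrite oppr0.
- by exists 1; rewrite ?oner_eq0 // oppr0 scale1r.
Qed.

Lemma dot_JJ u v : dh (J E u) (J E v) = dh u v.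
Proof. by rewrite !JE /double_form /= linearNl linearNr opprK addrC. Qed.

Lemma JJ u : J E (J E u) = - u.
Proof. by rewrite !JE; case: u. Qed.

Lemma dot_J u v : dh u (J E v) = - dh (J E u) v.
Proof. by rewrite -[in RHS]dot_JJ JJ linearNl opprK. Qed.

Lemma mem_J_img L v : (J E v \in (J E @: L)%VS) = (v \in L).
Proof.
apply/idP/idP => [/memv_imgP[u uL Jvu]|]; last exact: memv_img.
suff -> : v = u by [].
by apply: oppr_inj; rewrite -!JJ Jvu.
Qed.

(** Every vector has the form [J v], so the equality of subspaces can be tested on such vectors. It
    says that [L] is its own annihilator for the symplectic form [dh u (J E v)]. *)
Lemma lagrangianP (L : {vspace EE}) :
  lagrangian h L <-> forall v, v \in L <-> forall u, u \in L -> dh u (J E v) = 0.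
Proof.
have orthJ v : J E v \in orthov dh L <-> forall u, u \in L -> dh u (J E v) = 0.
  split=> [/mem_orthovP Lv u uL|Lv]; first by rewrite dot_conj Lv ?rmorph0.
  by apply/mem_orthovP => u uL; rewrite /= dot_conj /= Lv ?rmorph0.
split=> [LL v|LP]; first by rewrite -orthJ LL mem_J_img.
apply/vspaceP => w; have -> : w = J E (- J E w) by rewrite linearN /= JJ opprK.
by rewrite mem_J_img; apply/idP/idP => [/orthJ/LP//|/LP/orthJ].
Qed.

(** Pairing a basis vector of Lambda_I with [J v] gives, up to conjugation and a nonzero factor, the
    coefficient of [v] on the complementary vector of the same index. *)
Lemma Lambda_lagrangian I : lagrangian h (Lambda e I).
Proof.
apply/lagrangianP => v; rewrite mem_Lambda.
have dotJ i : dh (lagr_basis I (true, i)) (J E v) = 0 <->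
    dh v (lagr_basis I (false, i)) = 0.
  rewrite dot_J; have [a a0 ->] := J_lagr_basis I true i.
  rewrite dotZl /= [dh _ v]dot_conj; split=> /= [/eqP|->]; last first.
    by rewrite rmorph0 mulr0 oppr0.
  by rewrite oppr_eq0 mulf_eq0 (negPf a0) conjC_eq0 => /eqP.
split=> [v0 u|v0 i].
  rewrite LambdaE => /memv_frame[a ->]; rewrite dot_suml big1 // => i _.
  by rewrite dotZl /= (dotJ i).2 ?mulr0.
apply/dotJ/v0/mem_Lambda => j.
by rewrite dot_lagr_basis.
Qed.

(** The adjoint is prescribed by its coefficients in an orthonormal basis; the empty set is an
    arbitrary choice of such a basis. *)
Lemma adjoint_exists T : exists S, adjoint h T S.
Proof.
pose b := lagr_basis finset.set0.
have lin_g : linear (fun v => \sum_p dh v (T (b p)) *: b p).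
  move=> a u v; rewrite scaler_sumr -big_split /=; apply: eq_bigr => p _.
  by rewrite linearPl scalerDl scalerA.
exists (linfun (fun v => \sum_p dh v (T (b p)) *: b p)) => u v.
rewrite linfun_linearE // {1}(lagr_basis_expansion finset.set0 u).
rewrite linear_sum dot_suml dot_sumr; apply: eq_bigr => p _.
by rewrite linearZ /= dotZl dotZr /= -dot_conj mulrC.
Qed.

(** Nondegeneracy turns the operator identity into invariance of the symplectic form. It also gives
    injectivity: if [T u = T v], then [u - v] pairs to zero with every [J w], that is, with every
    vector. *)
Lemma symplecticP T :
  symplectic h T <-> forall u v, dh (T u) (J E (T v)) = dh u (J E v).
Proof.
split=> [[_ [S TS SJT]] u v|TJ].
  by rewrite TS -[in RHS]SJT !comp_lfunE.
split.
  apply/eqP/lker0P => u v Tuv; apply/eqP; rewrite -subr_eq0.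
  apply/eqP; apply: (@dot_eq0P _ _ dh) => w.
  have -> : w = J E (- J E w) by rewrite linearN /= JJ opprK.
  by rewrite /= -TJ linearB /= Tuv subrr linear0l.
have [S TS] := adjoint_exists T; exists S => //.
apply/lfunP => v; apply: (@dot_injr _ _ dh) => u.
by rewrite /= !comp_lfunE -TS TJ.
Qed.

Lemma symplectic_surj T : symplectic h T -> forall v, exists u, v = T u.
Proof.
move=> [/eqP kerT _] v.
have /memv_imgP[u _ ->] : v \in limg T by rewrite lker0_limgf ?memvf.
by exists u.
Qed.

Lemma symplectic_inj T : symplectic h T -> injective T.
Proof. by move=> [/eqP/lker0P]. Qed.

(** The criterion [lagrangianP] involves the symplectic form alone, and [T] is a bijection
    preserving it. *)
Lemma symplectic_img_lagrangian T (L : {vspace EE}) :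
  symplectic h T -> lagrangian h L -> lagrangian h (T @: L)%VS.
Proof.
move=> symT /lagrangianP LL; apply/lagrangianP => w.
have [v ->] := symplectic_surj symT w; have /symplecticP TJ := symT.
split=> [/memv_imgP[v' v'L /(symplectic_inj symT) ->{v}] u|w0].
  by move=> /memv_imgP[u' u'L ->]; rewrite TJ; apply: (LL v').1.
by apply/memv_img/LL => u uL; rewrite -TJ w0 ?memv_img.
Qed.

(** * The isotropic flag in the standard basis *)

Lemma be_lagr_basis i : be e i = lagr_basis [set: 'I_n] (true, i).
Proof. by rewrite /lagr_basis inE. Qed.

Lemma bf_lagr_basis i : bf e i = lagr_basis [set: 'I_n] (false, i).
Proof. by rewrite /lagr_basis inE. Qed.

Lemma mem_isotropic_flag l v : v \in isotropic_flag e l ->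
  (forall j, dh v (bf e j) = 0) /\
  (forall j : 'I_n, (j < n - l)%N -> dh v (be e j) = 0).
Proof.
rewrite /isotropic_flag -[X in <<X>>%VS]in_tupleE => /coord_span ->.
set s := in_tuple _.
(* Indices start at 0, so the filter [n - l < k.+1] reads [n - l <= k]. *)
have memX (i : 'I_(size s)) : exists2 k : 'I_n, (n - l <= k)%N & s`_i = be e k.
  have /mapP[k] : s`_i \in s := mem_nth 0 (ltn_ord i).
  by rewrite mem_filter => /andP[kl _] ->; exists k.
split=> j; [|move=> jl]; rewrite dot_suml big1 // => i _; rewrite dotZl /=;
  have [k kl ->] := memX i.
  by rewrite be_lagr_basis bf_lagr_basis dot_lagr_basis mulr0.
rewrite !be_lagr_basis dot_lagr_basis xpair_eqE /=.
by rewrite -val_eqE /= gtn_eqF ?mulr0 // (leq_trans jl).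
Qed.

Lemma be_isotropic_flag l (i : 'I_n) : (n - l <= i)%N -> be e i \in isotropic_flag e l.
Proof. by move=> li; apply/memv_span/map_f; rewrite mem_filter mem_enum andbT. Qed.

Lemma J_be i : J E (be e i) = bf e i.
Proof. by rewrite JE /be /bf /= oppr0. Qed.

Lemma J_bf i : J E (bf e i) = - be e i.
Proof. by rewrite -J_be JJ. Qed.

Lemma dot_bfbf i j : dh (bf e i) (bf e j) = (i == j)%:R.
Proof. by rewrite !bf_lagr_basis dot_lagr_basis xpair_eqE. Qed.

Lemma be_bf_expansion v :
  v = \sum_i dh v (be e i) *: be e i + \sum_i dh v (bf e i) *: bf e i.
Proof.
rewrite [LHS](lagr_basis_expansion [set: 'I_n]) sum_lagr_basis.
by congr (_ + _); apply: eq_bigr => i _; rewrite -?be_lagr_basis -?bf_lagr_basis.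
Qed.

(** * Matrix entries of an element of the Borel group *)

Section BorelTriangular.
Variable T : 'End(EE).
Hypothesis borelT : borel h e T.

(** [T] is injective, so the inclusion is an equality by dimension. *)
Lemma borel_isotropic_flag l : (1 <= l <= n)%N ->
  (T @: isotropic_flag e l)%VS = isotropic_flag e l.
Proof.
move=> ln; have [[kerT _] /(_ l ln) Tl] := borelT.
by apply/eqP; rewrite eqEdim Tl limg_dim_eq ?leqnn // kerT capv0.
Qed.

(** Level [n - i] is the smallest flag member containing [be i]; it is spanned by the [be j] with
    [i <= j]. *)
Lemma ord_flag_range (i : 'I_n) : (1 <= n - i <= n)%N.
Proof. by rewrite subn_gt0 ltn_ord leq_subr. Qed.

Lemma borel_be i :
  (forall j, dh (T (be e i)) (bf e j) = 0) /\
  (forall j : 'I_n, (j < i)%N -> dh (T (be e i)) (be e j) = 0).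
Proof.
have : T (be e i) \in isotropic_flag e (n - i).
  rewrite -(borel_isotropic_flag (ord_flag_range i)) memv_img //.
  by apply: be_isotropic_flag; rewrite subKn // ltnW.
move=> /mem_isotropic_flag[Tf Te]; split=> // j ji; apply: Te.
by rewrite subKn // ltnW.
Qed.

(* T maps each flag subspace onto itself, so be j is some T u with u in the flag
   and bf j = J (T u); symplecticity then moves T off both arguments. *)
Lemma borel_bf_upper (i j : 'I_n) : (i < j)%N -> dh (T (bf e i)) (bf e j) = 0.
Proof.
move=> ij; have [/symplecticP TJ _] := borelT.
have : be e j \in isotropic_flag e (n - j).
  by apply: be_isotropic_flag; rewrite subKn // ltnW.
rewrite -{1}(borel_isotropic_flag (ord_flag_range j)) => /memv_imgP[u uj ej].
have [_ /(_ i) ui] := mem_isotropic_flag uj.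
rewrite -(J_be j) ej TJ dot_J J_bf linearNl /= opprK dot_conj /= ui ?rmorph0 //.
by rewrite subKn // ltnW.
Qed.

(** Invariance of the symplectic form on [bf i], [be i] gives the value 1. In the expansion,
    [T (be i)] has only [be j] with [i <= j], while [T (bf i)] has no [bf j] with [i < j], so one
    product survives. *)
Lemma borel_diag i :
  (dh (T (be e i)) (be e i))^* * dh (T (bf e i)) (bf e i) = 1.
Proof.
have [/symplecticP TJ _] := borelT; have [Tf Te] := borel_be i.
have : dh (T (bf e i)) (J E (T (be e i))) = 1 by rewrite TJ J_be dot_bfbf eqxx.
rewrite {1}(be_bf_expansion (T (be e i))) [X in _ + X]big1 ?addr0; last first.
  by move=> j _; rewrite Tf scale0r.
rewrite linear_sum dot_sumr (bigD1 i) //= big1 => [|j ji].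
  by rewrite addr0 linearZ /= J_be dotZr.
rewrite linearZ /= J_be dotZr /=; case: (ltngtP j i) => [ji'|ij|/val_inj/eqP].
- by rewrite Te // rmorph0 mul0r.
- by rewrite borel_bf_upper ?mulr0.
- by rewrite (negPf ji).
Qed.

End BorelTriangular.

(** * Eigenvalues of [A] and strict triangularity *)

Section Weights.
Variables (R : realDomainType) (alpha : 'I_n -> R).
Hypothesis alpha_gt0 : forall i, 0 < alpha i.
Hypothesis alpha_incr : forall i j : 'I_n, (i < j)%N -> alpha i < alpha j.

(* The eigenvalue of A on lagr_basis I p. *)
Definition weight (I : {set 'I_n}) (p : bool * 'I_n) : R :=
  if p.1 == (p.2 \in I) then alpha p.2 else - alpha p.2.

Lemma ltN_alpha i j : - alpha i < alpha j.
Proof. by rewrite (lt_trans (y := 0)) ?oppr_lt0. Qed.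

Lemma alpha_le i j : (alpha i <= alpha j) = (i <= j)%N.
Proof.
case: (ltngtP i j) => [ij|ji|/val_inj ->]; last exact: lexx.
- by rewrite ltW ?alpha_incr.
- by rewrite leNgt alpha_incr.
Qed.

Lemma borel_diag_neq0 T I p : borel h e T ->
  dh (T (lagr_basis I p)) (lagr_basis I p) != 0.
Proof.
move=> borelT; have /(_ p.2) dT := borel_diag borelT; apply/eqP => d0.
move: d0 dT; rewrite /lagr_basis; case: ifP => _ ->.
  by rewrite rmorph0 mul0r => /eqP; rewrite eq_sym oner_eq0.
by rewrite mulr0 => /eqP; rewrite eq_sym oner_eq0.
Qed.

(** Off the diagonal, [be i] reaches only [be j] with larger [j], and [bf i] only [bf j] with
    smaller [j], where [- alpha j] is larger; passing from [bf] to [be] goes from a negative to a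
    positive eigenvalue, and the reverse never occurs. *)
Lemma borel_triangular T I p q : borel h e T -> p != q ->
  dh (T (lagr_basis I p)) (lagr_basis I q) != 0 -> weight I p < weight I q.
Proof.
move=> borelT; case: p q => [s i] [t j]; rewrite xpair_eqE negb_and => pq.
rewrite /lagr_basis /weight /=.
have [Tf Te] := borel_be borelT i.
have [si|si] := eqVneq s (i \in I); have [tj|tj] := eqVneq t (j \in I).
- have ij : i != j.
    by apply: contraTneq pq => ij; rewrite si tj ij !eqxx.
  rewrite lt_neqAle alpha_le leqNgt => Tij; apply/andP; split.
    by rewrite eq_le !alpha_le -eqn_leq.
  by apply: contra Tij => /Te ->.
- by rewrite Tf eqxx.
- by rewrite ltN_alpha.
- have ij : i != j.
    apply: contraTneq pq => ij; move: si tj; rewrite ij eqxx.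
    by case: s; case: t; case: (j \in I).
  rewrite ltrN2 lt_neqAle alpha_le leqNgt => Tij; apply/andP; split.
    by rewrite eq_le !alpha_le -eqn_leq eq_sym.
  by apply: contra Tij => /(borel_bf_upper borelT) ->.
Qed.

End Weights.

(** * Graphs over Lambda_I and the associated shears *)

Section Graph.
Variable I : {set 'I_n}.

(** Row [i] of [X] holds the image of the [i]-th basis vector of Lambda_I; these vectors span the
    graph of [X]. *)
Definition graph_vec (X : 'M[C]_n) (i : 'I_n) : EE :=
  lagr_basis I (true, i) + \sum_j X i j *: lagr_basis I (false, j).

Lemma frame_graph X : frame (graph_vec X) =
  frame (fun i => lagr_basis I (true, i)) +
  X *m frame (fun j => lagr_basis I (false, j)).
Proof.
apply/row_matrixP => i; rewrite linearD /= row_mul !rowK linearD /=; congr (_ + _).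
rewrite mulmx_sum_row linear_sum; apply: eq_bigr => j _.
by rewrite linearZ /= rowK mxE.
Qed.

(** The projection to the coefficients on one half of the basis, in [v2r] coordinates. The two
    values of [s] supply [P] and [Q] of [open_graph_lt1]. *)
Definition coord_mx (s : bool) : 'M[C]_(dim EE, n) :=
  \matrix_(k, i) dh (r2v (delta_mx 0 k)) (lagr_basis I (s, i)).

Lemma mul_coord_mx s v : v2r v *m coord_mx s = \row_i dh v (lagr_basis I (s, i)).
Proof.
apply/rowP => i; rewrite !mxE -[v in RHS]v2rK [v2r v in RHS]row_sum_delta.
rewrite linear_sum dot_suml; apply: eq_bigr => k _.
by rewrite linearZ dotZl !mxE.
Qed.

Lemma frame_mul_coord_mx s t :
  frame (fun i => lagr_basis I (s, i)) *m coord_mx t = if s == t then 1%:M else 0.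
Proof.
apply/row_matrixP => i; rewrite row_mul rowK mul_coord_mx; apply/rowP => j.
by rewrite mxE mxE dot_lagr_basis xpair_eqE; case: (s == t); rewrite !mxE.
Qed.

Lemma coord_mx_mul_frame :
  coord_mx true *m frame (fun i => lagr_basis I (true, i)) +
  coord_mx false *m frame (fun i => lagr_basis I (false, i)) = 1%:M.
Proof.
apply: eq_mulrV => r; rewrite mulmx1 -[r]r2vK; move: (r2v r) => v {r}.
rewrite mulmxDr !mulmxA !mul_coord_mx [in RHS](lagr_basis_expansion I v).
rewrite sum_lagr_basis linearD !linear_sum; congr (_ + _).
all: by rewrite mulmx_sum_row; apply: eq_bigr => i _; rewrite linearZ /= rowK mxE.
Qed.

(** Projecting both frames to Lambda_I forces the change of frame to be the identity; projecting to
    the other half then returns the graph matrices. *)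
Lemma graph_vec_inj X Y :
  mx2vs (frame (graph_vec X)) = mx2vs (frame (graph_vec Y)) -> X = Y.
Proof.
move=> /eq_mx2vs XY.
have /submxP[G GXY] : (frame (graph_vec X) <= frame (graph_vec Y))%MS by rewrite XY.
have coordT Z : frame (graph_vec Z) *m coord_mx true = 1%:M.
  by rewrite frame_graph mulmxDl -mulmxA !frame_mul_coord_mx /= mulmx0 addr0.
have coordF Z : frame (graph_vec Z) *m coord_mx false = Z.
  by rewrite frame_graph mulmxDl -mulmxA !frame_mul_coord_mx /= mulmx1 add0r.
have G1 : G = 1%:M by rewrite -(coordT X) GXY -mulmxA coordT mulmx1.
by rewrite -(coordF X) GXY G1 mul1mx coordF.
Qed.

Variable X : 'M[C]_n.

(* The identity on Lambda_(I^c), and id + X on Lambda_I. *)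
Definition shear (v : EE) : EE :=
  v + \sum_i dh v (lagr_basis I (true, i)) *:
      \sum_j X i j *: lagr_basis I (false, j).

Lemma shear_linear : linear shear.
Proof.
move=> a u v; rewrite /shear scalerDr addrACA; congr (_ + _).
rewrite scaler_sumr -big_split /=; apply: eq_bigr => i _.
by rewrite linearPl scalerDl scalerA.
Qed.

Lemma shear_true i : shear (lagr_basis I (true, i)) = graph_vec X i.
Proof.
rewrite /shear /graph_vec (bigD1 i) //= dot_lagr_basis eqxx scale1r.
rewrite [X in _ + (_ + X)]big1 ?addr0 // => j ji.
by rewrite dot_lagr_basis xpair_eqE eq_sym (negPf ji) scale0r.
Qed.

Lemma shear_false i : shear (lagr_basis I (false, i)) = lagr_basis I (false, i).
Proof.
rewrite /shear big1 ?addr0 // => j _.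
by rewrite dot_lagr_basis scale0r.
Qed.

Lemma dot_J_isotropic s (a b : 'I_n -> C) :
  dh (\sum_i a i *: lagr_basis I (s, i)) (J E (\sum_i b i *: lagr_basis I (s, i))) = 0.
Proof.
rewrite dot_suml big1 // => i _; rewrite linear_sum dot_sumr big1 // => j _.
have [c _ Jc] := J_lagr_basis I s j.
rewrite linearZ /= Jc dotZl !dotZr /= dot_lagr_basis xpair_eqE.
by case: s {Jc}; rewrite /= !mulr0.
Qed.

(** Write a vector as [p + q] along the two halves; its shear is [(p + x) + q]. The form vanishes on
    the Lagrangian graph, which contains [p + x], and on the second half, which contains [x] and
    [q]. The same [p]-[q] cross terms remain on both sides. *)
Lemma shear_symplectic :
  lagrangian h (mx2vs (frame (graph_vec X))) -> symplectic h (linfun shear).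
Proof.
move=> /lagrangianP LX; apply/symplecticP => u v.
rewrite !(linfun_linearE shear_linear).
pose p w := \sum_i dh w (lagr_basis I (true, i)) *: lagr_basis I (true, i).
pose q w := \sum_i dh w (lagr_basis I (false, i)) *: lagr_basis I (false, i).
pose x w := \sum_j
  (\sum_i dh w (lagr_basis I (true, i)) * X i j) *: lagr_basis I (false, j).
have pqE w : w = p w + q w by rewrite {1}(lagr_basis_expansion I w) sum_lagr_basis.
have xE w : \sum_i dh w (lagr_basis I (true, i)) *:
    (\sum_j X i j *: lagr_basis I (false, j)) = x w.
  under eq_bigr do rewrite scaler_sumr.
  rewrite exchange_big /=; apply: eq_bigr => j _; rewrite scaler_suml.
  by apply: eq_bigr => i _; rewrite scalerA.
have shearE w : shear w = p w + x w + q w by rewrite /shear xE {1}(pqE w) addrAC.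
have pxL w : p w + x w \in mx2vs (frame (graph_vec X)).
  apply/memv_frame; exists (fun i => dh w (lagr_basis I (true, i))).
  by rewrite -xE -big_split /=; apply: eq_bigr => i _; rewrite scalerDr.
pose w a b := dh a (J E b).
have wDl a b c : w (a + b) c = w a c + w b c by rewrite /w linearDl.
have wDr a b c : w a (b + c) = w a b + w a c by rewrite /w linearD linearDr.
have w_px : w (p u + x u) (p v + x v) = 0 by exact: (LX _).1 (pxL v) _ (pxL u).
have w_pp : w (p u) (p v) = 0 by exact: dot_J_isotropic.
have w_qq : w (q u) (q v) = 0 by exact: dot_J_isotropic.
have w_xq : w (x u) (q v) = 0 by exact: dot_J_isotropic.
have w_qx : w (q u) (x v) = 0 by exact: dot_J_isotropic.
rewrite !shearE [in RHS](pqE u) [in RHS](pqE v) -/(w _ _) -/(w (p u + q u) _).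
rewrite (wDl _ (q u)) !(wDr _ _ (q v)) w_px (wDl (p u) (x u)) w_xq w_qq wDr w_qx.
by rewrite !(wDl (p u)) w_pp w_qq !add0r !addr0 addrC.
Qed.

End Graph.

Lemma shear_img_Lambda I X :
  (linfun (shear I X) @: (Lambda e I : {vspace EE}))%VS = mx2vs (frame (graph_vec I X)).
Proof.
rewrite LambdaE lfun_img_frame; congr (mx2vs (frame _)); apply/funext => i /=.
by rewrite (linfun_linearE (shear_linear I X)) shear_true.
Qed.

(** A vector [be i] with [i] outside [I] is fixed. For [i] in [I], the sign condition on the weights
    lets [X] add only vectors [be j] with [i <= j], which lie in the same flag members. *)
Lemma shear_borel (R : realDomainType) (alpha : 'I_n -> R) I X :
  (forall i, 0 < alpha i) ->
  (forall i j : 'I_n, (i < j)%N -> alpha i < alpha j) ->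
  lagrangian h (mx2vs (frame (graph_vec I X))) ->
  (forall i j, X i j != 0 -> weight alpha I (true, i) <= weight alpha I (false, j)) ->
  borel h e (linfun (shear I X)).
Proof.
move=> alpha_gt0 alpha_incr LX X0; split; first exact: shear_symplectic.
move=> l _; rewrite {1}/isotropic_flag limg_span; apply/span_subvP.
move=> _ /mapP[_ /mapP[i + ->] ->].
rewrite mem_filter ltnS => /andP[li _]; rewrite (linfun_linearE (shear_linear I X)).
have [iI|iNI] := boolP (i \in I); last first.
  have -> : be e i = lagr_basis I (false, i) by rewrite /lagr_basis /= (negPf iNI).
  rewrite shear_false /lagr_basis /= (negPf iNI).
  exact: be_isotropic_flag.
have ei : be e i = lagr_basis I (true, i) by rewrite /lagr_basis /= iI.
rewrite ei shear_true; apply: memvD; first by rewrite -ei; exact: be_isotropic_flag.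
apply: memv_suml => j _; have [->|Xij] := eqVneq (X i j) 0.
  by rewrite scale0r mem0v.
apply: memvZ; have := X0 _ _ Xij; rewrite /weight /lagr_basis /= iI /=.
(* For [j] in [I] the added vector would be [bf j], whose negative weight cannot bound [alpha i]. *)
case: (boolP (j \in I)) => jI /=.
  by move=> /(lt_le_trans (ltN_alpha alpha_gt0 j i)); rewrite ltxx.
rewrite (alpha_le alpha_incr) => ij.
by apply: be_isotropic_flag; exact: leq_trans ij.
Qed.

End OrthonormalBasis.

(** * The flow *)

Lemma cvg_expR_ltr0 (R : realType) (a : R) : a < 0 -> expR (t * a) @[t --> +oo] --> 0.
Proof.
move=> a0; rewrite (_ : (fun t => _) = (fun s => expR (- s)) \o (fun t => t * - a)).
  apply: cvg_comp (@cvgr_expR R); apply/cvgryPge => B; near=> t.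
  by rewrite -ler_pdivrMr ?oppr_gt0 //; near: t; exact: nbhs_pinfty_ge.
by apply/funext => t /=; rewrite mulrN opprK.
Unshelve. all: by end_near. Qed.

Lemma near_expRM_lt1 (R : realType) (z : R[i]) (a : R) : 0 < a ->
  (\forall t \near +oo, `|(expR (t * a))%:C * z| < 1) -> z = 0.
Proof.
move=> a0 small; apply/eqP/negPn/negP => z0.
have [r r0 zr] : exists2 r : R, 0 < r & `|z| = r%:C.
  exists (Num.sqrt (complex.Re z ^+ 2 + complex.Im z ^+ 2)); last exact: normc_def.
  by rewrite -ltcR -normc_def normr_gt0.
(* At such a [t], [expR (t * a)] is at least [1 + t * a], hence at least [r^-1], and the product has
   norm at least 1. *)
have /filter_ex[t [+ tr]] : \forall t \near +oo,
    `|(expR (t * a))%:C * z| < 1 /\ (a * r)^-1 <= t.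
  by apply: filterI small _; apply: nbhs_pinfty_ge; rewrite num_real.
rewrite normrM zr normc_def /= expr0n addr0 sqrtr_sqr ger0_norm ?expR_ge0 //.
rewrite -rmorphM /= -(rmorph1 (real_complex R)) ltcR ltNge => /negP; apply.
rewrite -ler_pdivrMr // div1r (le_trans _ (expR_ge1Dx _)) // ler_wpDl //.
by rewrite -ler_pdivrMr // -invfM mulrC.
Qed.

Section Flow.
Variables (R : realType) (n : nat) (E : vectType R[i]) (h : {dot E for Num.conj}).
Variable e : n.-tuple E.
Hypothesis e_basis : basis_of {:E}%VS e.
Hypothesis e_orthonormal : orthonormal h e.
Variable alpha : 'I_n -> R.
Hypothesis alpha_gt0 : forall i, 0 < alpha i.
Hypothesis alpha_incr : forall i j : 'I_n, (i < j)%N -> alpha i < alpha j.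
Variable I : {set 'I_n}.
Local Notation g p := (lagr_basis e I p).
Local Notation w p := (weight alpha I p).
Local Notation dh := (double_form h).

Section Explf.
Variable A : 'End((E * E)%type).
Hypothesis A_be : forall i, A (be e i) = (alpha i)%:C *: be e i.
Hypothesis A_bf : forall i, A (bf e i) = - (alpha i)%:C *: bf e i.

Lemma A_lagr_basis p : A (g p) = (w p)%:C *: g p.
Proof.
rewrite /lagr_basis /weight; case: ifP => _; first exact: A_be.
by rewrite A_bf rmorphN.
Qed.

(** The orthogonal projections onto the eigenlines form the resolution of the identity required by
    [explf_spectral]. *)
Lemma explf_lagr_basis t p : explf ((- t)%:C *: A) (g p) = (expR (- t * w p))%:C *: g p.
Proof.
have proj_linear q : linear (fun v => dh v (g q) *: g q).
  by move=> a u v; rewrite linearPl scalerDl scalerA.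
pose P q : 'End((E * E)%type) := linfun (fun v => dh v (g q) *: g q).
have PE q v : P q v = dh v (g q) *: g q by exact: (linfun_linearE (proj_linear q)).
rewrite (@explf_spectral _ _ _ _ P (fun q => (- t * w q)%:C) _ _
  (fun q => (expR (- t * w q))%:C)).
- rewrite sum_lfunE (bigD1 p) //= scale_lfunE PE dot_lagr_basis // eqxx scale1r.
  rewrite big1 ?addr0 // => q qp.
  by rewrite scale_lfunE PE dot_lagr_basis // eq_sym (negPf qp) scale0r scaler0.
- apply/lfunP => v; rewrite sum_lfunE id_lfunE.
  rewrite [RHS](lagr_basis_expansion e_basis e_orthonormal I).
  by apply: eq_bigr => q _; rewrite PE.
- move=> q; apply/lfunP => v; rewrite comp_lfunE !scale_lfunE PE linearZ /=.
  by rewrite A_lagr_basis !scalerA rmorphM mulrAC.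
- by move=> q; exact: (@cvg_series_expc R (- t * w q)).
Qed.

End Explf.

(** * Long-time behaviour of a flow known by its eigenvalues *)

Variable flow : R -> 'End((E * E)%type).
Hypothesis flow_lagr_basis : forall t p,
  flow t (g p) = (expR (- t * w p))%:C *: g p.

Lemma flowK t v : flow (- t) (flow t v) = v.
Proof.
rewrite (lagr_basis_expansion e_basis e_orthonormal I v) !linear_sum.
apply: eq_bigr => p _; rewrite !linearZ /= flow_lagr_basis linearZ /= flow_lagr_basis.
congr (_ *: _).
by rewrite scalerA -rmorphM -expRD opprK mulNr addNr expR0 scale1r.
Qed.

(** Each image vector is rescaled so that its Lambda_I part is again a basis vector; the entries
    then carry the ratio of two exponentials. *)
Lemma flow_graph t (X : 'M[R[i]]_n) :
  (flow t @: mx2vs (frame (graph_vec e I X)))%VS =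
  mx2vs (frame (graph_vec e I
    (\matrix_(i, j) ((expR (t * (w (true, i) - w (false, j))))%:C * X i j)))).
Proof.
rewrite lfun_img_frame.
rewrite -(mx2vs_frameZ (graph_vec e I _) (a := fun i => (expR (- t * w (true, i)))%:C));
  last by move=> i; rewrite fmorph_eq0 gt_eqF ?expR_gt0.
congr (mx2vs (frame _)); apply/funext => i /=.
rewrite /graph_vec linearD linear_sum /= flow_lagr_basis scalerDr; congr (_ + _).
rewrite scaler_sumr; apply: eq_bigr => j _; rewrite linearZ /= flow_lagr_basis.
rewrite !scalerA mxE mulrA -rmorphM -expRD mulrC; congr ((expR _)%:C * _ *: _).
by rewrite mulrBr !mulNr addKr.
Qed.

Lemma cvg_flow_graph (L : {vspace (E * E)%type}) :
  ((flow t @: L)%VS : grassmannian (E * E)%type) @[t --> +oo] --> Lambda e I ->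
  exists X : 'M[R[i]]_n, L = mx2vs (frame (graph_vec e I X)) /\
    forall i j, X i j != 0 -> w (true, i) <= w (false, j).
Proof.
move=> cvgL; pose G X := mx2vs (frame (graph_vec e I X)).
pose U : set (grassmannian (E * E)%type) :=
  [set M | exists2 X : 'M[R[i]]_n, M = G X & forall i j, `|X i j| < 1].
have oU : open U.
  have := open_graph_lt1 (frame_mul_coord_mx e_orthonormal I true true)
    (frame_mul_coord_mx e_orthonormal I false true)
    (frame_mul_coord_mx e_orthonormal I true false)
    (frame_mul_coord_mx e_orthonormal I false false)
    (coord_mx_mul_frame e_basis e_orthonormal I).
  congr open; apply/funext => M; apply/propext.
  by split=> -[X MX X1]; exists X; rewrite // MX /G frame_graph.
have UI : U (Lambda e I).
  exists 0 => [|i j]; last by rewrite mxE normr0 ltr01.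
  rewrite LambdaE /G; congr (mx2vs (frame _)); apply/funext => i.
  by rewrite /graph_vec big1 ?addr0 // => j _; rewrite mxE scale0r.
have nearU : \forall t \near +oo, U (flow t @: L)%VS.
  exact: cvgL _ (open_nbhs_nbhs (conj oU UI)).
(* A single time [t0] at which the image is a graph suffices: [flow (- t0)] carries it back to [L]
   and sends graphs to graphs. *)
have [t0 [Y LY _]] := filter_ex nearU.
have LX : L = G (\matrix_(i, j)
    ((expR (- t0 * (w (true, i) - w (false, j))))%:C * Y i j)).
  rewrite /G -(flow_graph (- t0) Y) -/(G Y) -LY -limg_comp.
  suff -> : (flow (- t0) \o flow t0)%VF = \1%VF by rewrite lim1g.
  by apply/lfunP => v; rewrite comp_lfunE id_lfunE flowK.
move: (\matrix_(i, j) _) LX => X LX; exists X; split=> // i j.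
(* If the inequality fails, the entry is multiplied by a growing exponential yet stays below 1 in
   norm for all large [t], so it vanishes. *)
apply: contra_neqT; rewrite -ltNge -subr_gt0 => wij.
apply: near_expRM_lt1 wij _; apply: filterS nearU => t [Z LZ Z1].
move: LZ; rewrite LX /G flow_graph => /(graph_vec_inj e_orthonormal) ZE.
by have := Z1 i j; rewrite -ZE mxE.
Qed.

Lemma cvg_flow_borel (T : 'End((E * E)%type)) : borel h e T ->
  ((flow t @: (T @: (Lambda e I : {vspace _})))%VS : grassmannian (E * E)%type)
    @[t --> +oo] --> Lambda e I.
Proof.
move=> borelT; pose d i := dh (T (g (true, i))) (g (true, i)).
have d0 i : d i != 0 by exact: (borel_diag_neq0 e_basis e_orthonormal _ _ borelT).
(* This scaling makes the coefficient of [f t i] on [g (true, i)] equal to 1; by triangularity the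
   other coefficients are zero or decay. *)
pose f t i := ((expR (t * w (true, i)))%:C / d i) *: flow t (T (g (true, i))).
have fE t : (flow t @: (T @: (Lambda e I : {vspace _})))%VS = mx2vs (frame (f t)).
  rewrite LambdaE !lfun_img_frame mx2vs_frameZ // => i.
  by rewrite mulf_neq0 ?invr_eq0 // fmorph_eq0 gt_eqF ?expR_gt0.
rewrite (_ : (fun t => _) = (fun t => mx2vs (frame (f t)))); last first.
  by apply/funext => t; exact: fE.
have g_free : row_free (frame (fun i => g (true, i))).
  by apply/row_freeP; exists (coord_mx h e I true); rewrite frame_mul_coord_mx.
(* Freeness follows by counting dimensions, as [T] and [flow t] are injective. *)
have f_free t : row_free (frame (f t)).
  have flow0 : lker (flow t) = 0%VS by apply/eqP/lker0P; exact: can_inj (flowK t).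
  have T0 : lker T = 0%VS by case: borelT => -[].
  rewrite /row_free -dim_mx2vs -fE !limg_dim_eq ?flow0 ?T0 ?capv0 //.
  by rewrite LambdaE dim_mx2vs.
rewrite LambdaE; apply: cvg_mx2vs => //; apply: cvg_frame => i.
have fE' t : f t i = \sum_q ((expR (t * (w (true, i) - w q)))%:C *
    (dh (T (g (true, i))) (g q) / d i)) *: g q.
  rewrite /f {1}(lagr_basis_expansion e_basis e_orthonormal I (T (g (true, i)))).
  rewrite linear_sum scaler_sumr; apply: eq_bigr => q _.
  rewrite linearZ /= flow_lagr_basis !scalerA mulrBr -mulNr expRD rmorphM.
  rewrite -!mulrA; congr ((_ * _) *: _).
  by rewrite mulrC mulrAC mulrC.
rewrite (_ : (fun t => _) = fun t => \sum_q ((expR (t * (w (true, i) - w q)))%:C *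
    (dh (T (g (true, i))) (g q) / d i)) *: v2r (g q)); last first.
  apply/funext => t; rewrite fE' linear_sum; apply: eq_bigr => q _.
  exact: linearZ.
(* Writing the limit as a sum over the whole basis reduces convergence to that of each
   coefficient. *)
have -> : v2r (g (true, i)) = \sum_q ((true, i) == q)%:R *: v2r (g q).
  rewrite (bigD1 (true, i)) //= eqxx scale1r big1 ?addr0 // => q qi.
  by rewrite eq_sym (negPf qi) scale0r.
apply: cvg_sumr => q _; apply: cvgZr_tmp.
have [<-|qi] := eqVneq (true, i) q.
  rewrite (_ : (fun t => _) = fun=> 1); first exact: cvg_cst.
  by apply/funext => t; rewrite subrr mulr0 expR0 mul1r divff //; exact: d0.
have [Tq|Tq] := eqVneq (dh (T (g (true, i))) (g q)) 0.
  rewrite (_ : (fun t => _) = fun=> 0); first exact: cvg_cst.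
  by apply/funext => t; rewrite Tq mul0r mulr0.
have wq := borel_triangular e_basis e_orthonormal alpha_gt0 alpha_incr borelT qi Tq.
rewrite -[X in _ --> X](mul0r (dh (T (g (true, i))) (g q) / d i)).
apply: cvgM; last exact: cvg_cst.
by apply: cvg_realc; apply: cvg_expR_ltr0; rewrite subr_lt0.
Qed.

End Flow.

Theorem proposition3p6 (R : realType) (n : nat) (E : vectType R[i])
    (h : {dot E for Num.conj}) (e : n.-tuple E)
    (e_basis : basis_of {:E}%VS e) (e_orthonormal : orthonormal h e)
    (alpha : 'I_n -> R) (alpha_gt0 : forall i, 0 < alpha i)
    (alpha_incr : forall i j : 'I_n, (i < j)%N -> alpha i < alpha j)
    (A : 'End((E * E)%type))
    (A_be : forall i, A (be e i) = (alpha i)%:C *: be e i)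
    (A_bf : forall i, A (bf e i) = - (alpha i)%:C *: bf e i)
    (I : {set 'I_n}) :
  unstable_manifold h e A I =
  [set (T @: (Lambda e I : {vspace E * E}))%VS | T in borel h e].
Proof.
have flowE := explf_lagr_basis e_basis e_orthonormal I A_be A_bf.
apply/seteqP; split=> L.
  move=> [LL cvgL].
  have [X [LX X0]] := cvg_flow_graph e_basis e_orthonormal
    (flow := fun t => explf ((- t)%:C *: A)) flowE cvgL.
  exists (linfun (shear h e I X)); last by rewrite shear_img_Lambda.
  by apply: (shear_borel e_basis e_orthonormal alpha_gt0 alpha_incr); rewrite -?LX.
move=> [T borelT <-]; split.
  exact: (symplectic_img_lagrangian e_basis e_orthonormal borelT.1
    (Lambda_lagrangian e_basis e_orthonormal I)).
exact: (cvg_flow_borel e_basis e_orthonormal alpha_gt0 alpha_incr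
  (flow := fun t => explf ((- t)%:C *: A)) flowE borelT).
Qed.
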